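(* Let $X$ be a finite discrete topological space with at least two elements, let $\Gamma$ be a nonempty set, and let $\varphi:\Gamma\to\Gamma$ be an arbitrary map. Let $\sigma_\varphi:X^\Gamma\to X^\Gamma$, $\sigma_\varphi((x_\theta)_{\theta\in\Gamma})=(x_{\varphi(\theta)})_{\theta\in\Gamma}$, be the associated generalized shift, where $X^\Gamma$ carries the product topology and its unique compatible uniform structure $\mathcal U$. The following statements are equivalent: (1) $(X^\Gamma,\sigma_\varphi)$ has weak specification property; (2) $(X^\Gamma,\sigma_\varphi)$ has almost weak specification property; (3) $\varphi:\Gamma\to\Gamma$ does not have any periodic point.
   Context: Periodic point: a point $\theta\in\Gamma$ is a periodic point of $\varphi:\Gamma\to\Gamma$ if there exists $n\ge 1$ with $\varphi^n(\theta)=\theta$. Uniform structure on $X^\Gamma$: for $H\subseteq\Gamma$ let $\alpha_H:=\{((x_\theta)_{\theta\in\Gamma},(y_\theta)_{\theta\in\Gamma})\in X^\Gamma\times X^\Gamma:\forall\theta\in H\ (x_\theta=y_\theta)\}$. The unique compatible uniform structure on the compact Hausdorff space $X^\Gamma$ is $\mathcal U:=\{D\subseteq X^\Gamma\times X^\Gamma:$ there exists a finite subset $H$ of $\Gamma$ with $\alpha_H\subseteq D\}$. Specification properties: let $(Y,\mathcal F)$ be a uniform topological space and $h:Y\to Y$ continuous; $\mathbb Z_+$ denotes the nonnegative integers. The dynamical system $(Y,h)$ has almost weak specification property if for every $\alpha\in\mathcal F$ there exists a map $N_\alpha:\mathbb Z_+\to\mathbb Z_+$ with $\lim_{n\to\infty}\frac{N_\alpha(n)}{n}=0$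 such that for all $n\ge2$, all $y_1,\ldots,y_n\in Y$ and all integers $0\le l_1\le k_1<l_2\le k_2<\cdots<l_n\le k_n$ with $l_{i+1}-k_i\ge N_\alpha(k_{i+1}-l_{i+1})$ for $i=1,\ldots,n-1$, there exists $x\in Y$ such that $(h^i(x),h^i(y_j))\in\alpha$ for all $j\in\{1,\ldots,n\}$ and all $i\in\{l_j,l_j+1,\ldots,k_j\}$. It has weak specification property if, for every $\alpha\in\mathcal F$, the map $N_\alpha$ in this definition can moreover be taken to be constant. *)

(* Defs.v *)
From HB Require Import structures.
From mathcomp Require Import all_boot all_order all_algebra.
From mathcomp Require Import all_classical all_reals all_analysis.

Set Implicit Arguments.
Unset Strict Implicit.
Unset Printing Implicit Defensive.

Import Order.TTheory GRing.Theory Num.Theory.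
Import numFieldNormedType.Exports.

Local Open Scope classical_set_scope.
Local Open Scope ring_scope.

Definition periodic_point (G : Type) (phi : G -> G) (t : G) : Prop :=
  exists n : nat, (1 <= n)%N /\ iter n phi t = t.

Section Specification.
Context (R : realType) (Y : uniformType).
Implicit Types (h : Y -> Y) (alpha : set (Y * Y)) (N : nat -> nat).

(* The n orbit segments are indexed by 'I_n, i.e. by 0, ..., n - 1 instead of
   1, ..., n. None of the natural number subtractions is truncated, since
   l j <= k j for all j and k i < l j when j is the successor of i. *)
Definition specification_gap h alpha N : Prop :=
  (fun n : nat => (N n)%:R / n%:R : R) @ \oo --> (0 : R) /\
  forall (n : nat) (y : 'I_n -> Y) (l k : 'I_n -> nat),
    (2 <= n)%N ->
    (forall j, (l j <= k j)%N) ->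
    (forall i j : 'I_n, j = i.+1 :> nat -> (k i < l j)%N) ->
    (forall i j : 'I_n, j = i.+1 :> nat ->
      (N (k j - l j) <= l j - k i)%N) ->
    exists x : Y, forall (j : 'I_n) (i : nat), (l j <= i <= k j)%N ->
      alpha (iter i h x, iter i h (y j)).

Definition almost_weak_specification h : Prop :=
  forall alpha, entourage alpha ->
    exists N : nat -> nat, specification_gap h alpha N.

Definition weak_specification h : Prop :=
  forall alpha, entourage alpha ->
    exists M : nat, specification_gap h alpha (fun=> M).

End Specification.

Section FullShift.
Context (X : finType) (G : Type).

(* X carries the discrete uniformity, and X^G the product uniformity; see
   entourage_full_shiftE below for an explicit description. *)
Definition full_shift : uniformType := {ptws G -> discrete_topology X}.

Definition generalized_shift (phi : G -> G) (x : full_shift) : full_shift :=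
  fun t => x (phi t).

Definition agree_on (H : set G) : set (full_shift * full_shift) :=
  [set xy | forall t, H t -> xy.1 t = xy.2 t].

Lemma entourage_full_shiftE :
  @entourage full_shift =
  [set D | exists2 H : set G, finite_set H & agree_on H `<=` D].
Proof.
rewrite {1}/entourage /= /sup_ent /= smallest_filter_finI.
rewrite eqEsubset; split => [D|D [H finH HD]].
  apply; split.
    apply: Build_Filter.
    - by exists set0; [exact: finite_set0|].
    - move=> A B [H finH HA] [K finK KB]; exists (H `|` K).
        by rewrite finite_setU.
      by move=> xy HKxy; split; [apply: HA|apply: KB] => t ?;
        apply: HKxy; [left|right].
    - by move=> A B AB [H finH HA]; exists H => //; apply: subset_trans AB.
  move=> _ [[[t E] /= +] _ <-] => /asboolP /= [V entV VE].
  exists [set t]; first exact: finite_set1.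
  move=> [x y] /= /(_ t erefl) /= xyt; apply: VE => /=.
  by change (V (x t, y t)); rewrite -xyt; exact: entourage_refl.
move=> F [filterF subF]; apply: (filterS HD).
have -> : agree_on H = \bigcap_(t in H) agree_on [set t].
  by rewrite eqEsubset; split => [xy Hxy t Ht _ ->|xy Hxy t Ht];
    [exact: Hxy|exact: (Hxy t Ht)].
have [s ->] := (finite_fsetP (A := H : set {classic G})).1 finH.
apply: (@filter_bigI _ {classic G} s (fun t => agree_on [set t]) F) => t _.
apply: subF.
have P : `[< @entourage (initial_topology
    (@proj G (fun=> discrete_topology X) t)) (agree_on [set t]) >].
  apply/asboolP; exists (range (fun x => (x, x))).
    by move=> ? [x _ <-]; exists x.
  move=> [x y] /= [u _ [eux euy]] _ ->.
  exact: etrans (esym eux) euy.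
by exists (exist _ (t, agree_on [set t]) P).
Qed.

Lemma continuous_generalized_shift (phi : G -> G) :
  continuous (generalized_shift phi).
Proof.
move=> x A /nbhsP[D]; rewrite entourage_full_shiftE => -[H finH HD] DA.
apply/nbhsP; exists (agree_on (phi @` H)).
  by rewrite entourage_full_shiftE; exists (phi @` H) => //; exact: finite_image.
move=> y /xsectionP /= Hxy; apply: DA; apply/xsectionP; apply: HD => t Ht /=.
by apply: Hxy; exists t.
Qed.

End FullShift.

(* Main.v *)
Require Import Defs.
From HB Require Import structures.
From mathcomp Require Import all_boot all_order all_algebra.
From mathcomp Require Import all_classical all_reals all_analysis.
From mathcomp Require Import zify.

(** A generalized shift only moves coordinates along the orbits of [phi]:
    coordinate [t] of the [i]-th iterate of [x] is coordinate [phi^i t] of [x].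
    Two configurations being close means agreeing on a finite set [H] of
    coordinates, so shadowing [y j] during the times [l j, ..., k j] amounts to
    prescribing [x] to be [y j] on the coordinates [phi^i t], for [t] in [H] and
    [i] in the [j]-th segment. Shadowing all the segments at once is possible as
    soon as no coordinate is prescribed by two different segments
    ([glue_disjoint]).

    Without periodic points, [phi^i t = phi^i' t'] determines the lag [i' - i]
    from [t] and [t'] alone, because two different lags would close up the orbit
    of [t'] into a cycle ([orbit_lag_unique]). As [H] is finite, the lags between
    its points are bounded by a constant [M] ([orbit_lag_bounded]). Segments
    which are at least [M] apart ([segments_apart]) hence never collide, and the
    constant [M] witnesses weak specification.

    Conversely, if [phi^p t = t] with [p >= 1], coordinate [t] takes the same
    value at times [0] and [p * m] for all [m], so it can never shadow the
    constant configuration [a] at time [0] and another constant [b] at time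
    [p * m], however large the gap [p * m] is. These two segments consist of a
    single time each, so the gap demanded by the almost weak property is the
    fixed number [N 0], and some multiple of [p] exceeds it
    ([almost_weak_specification_aperiodic]). *)

Set Implicit Arguments.
Unset Strict Implicit.
Unset Printing Implicit Defensive.

Import GRing.Theory numFieldNormedType.Exports.

Local Open Scope classical_set_scope.

Lemma iter_generalized_shift (X : finType) (G : Type) (phi : G -> G) (i : nat)
    (x : full_shift X G) (t : G) :
  iter i (@generalized_shift X G phi) x t = x (iter i phi t).
Proof. by elim: i t => //= i IH t; rewrite /generalized_shift IH -iterSr. Qed.

Section OrbitLags.
Context (G : Type) (phi : G -> G).

Lemma iter_periodM (t : G) (p m : nat) :
  iter p phi t = t -> iter (p * m) phi t = t.
Proof.
by move=> pt; elim: m => [|m IH]; rewrite ?muln0// mulnS iterD IH pt.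
Qed.

Lemma iter_lt_periodic (t : G) (a b : nat) :
  (a < b)%N -> iter a phi t = iter b phi t -> exists u, periodic_point phi u.
Proof.
move=> ab e; exists (iter a phi t), (b - a)%N; split; first by rewrite subn_gt0.
by rewrite -iterD subnK// ltnW.
Qed.

Hypothesis aperiodic : ~ exists t, periodic_point phi t.

Lemma iter_aperiodic_inj (t : G) (a b : nat) :
  iter a phi t = iter b phi t -> a = b.
Proof.
move=> e; case: (ltngtP a b) => // lt_ab; exfalso; apply: aperiodic.
  exact: iter_lt_periodic lt_ab e.
exact: iter_lt_periodic lt_ab (esym e).
Qed.

(** Both coincidences express the point [phi^(i + m) t] as an iterate of [t'],
    with exponents [i' + m] and [m' + i], and aperiodicity makes the exponents
    equal. The conclusion is [i' - i = m' - m], free of truncation. *)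
Lemma orbit_lag_unique (t t' : G) (i i' m m' : nat) :
  iter i phi t = iter i' phi t' -> iter m phi t = iter m' phi t' ->
  (i' + m = m' + i)%N.
Proof.
move=> ei em; apply: (@iter_aperiodic_inj t').
by rewrite addnC iterD -ei -iterD addnC iterD em -iterD addnC.
Qed.

Lemma orbit_lag_bounded_pair (tt' : G * G) : exists M, forall i i',
  iter i phi tt'.1 = iter i' phi tt'.2 -> (i' < i + M)%N.
Proof.
case: tt' => t t' /=.
have [[m [m' em]]|no] :=
    pselect (exists m m', iter m phi t = iter m' phi t').
  by exists m'.+1 => i i' ei; have := orbit_lag_unique ei em; lia.
by exists 0%N => i i' ei; exfalso; apply: no; exists i, i'.
Qed.

Lemma orbit_lag_bounded (H : set G) : finite_set H ->
  exists M, forall t t' i i', H t -> H t' ->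
    iter i phi t = iter i' phi t' -> (i' < i + M)%N.
Proof.
move=> finH; have [B BP] := choice orbit_lag_bounded_pair.
have /finite_seqP[s sE] : finite_set (B @` (H `*` H)).
  by apply: finite_image; exact: finite_setX.
exists (\max_(b <- s) b) => t t' i i' Ht Ht' e.
have /= lt_i' := BP (t, t') _ _ e; apply: leq_trans lt_i' _.
have B_s : B (t, t') \in s.
  have : (B @` (H `*` H)) (B (t, t')) by exists (t, t').
  by rewrite sE.
by rewrite leq_add2l (@leq_bigmax_seq _ s xpredT id).
Qed.

End OrbitLags.

(** Specification only constrains the gaps between consecutive segments; the
    bound passes on to later segments because no segment ends before it starts
    and each ends before the next one starts. *)
Lemma segments_apart (M n : nat) (l k : 'I_n -> nat) :
    (forall j, (l j <= k j)%N) ->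
    (forall i j : 'I_n, j = i.+1 :> nat -> (k i < l j)%N) ->
    (forall i j : 'I_n, j = i.+1 :> nat -> (M <= l j - k i)%N) ->
  forall i j : 'I_n, (i < j)%N -> (k i + M <= l j)%N.
Proof.
move=> lk kl gap i j; move jm : (j : nat) => m.
elim: m j jm => // m IH j jm.
rewrite ltnS leq_eqVlt => /orP[/eqP im|im].
  have ij : j = i.+1 :> nat by rewrite jm im.
  by have := gap _ _ ij; have := kl _ _ ij; lia.
have mn : (m < n)%N by have := ltn_ord j; lia.
have := IH (Ordinal mn) erefl im.
by have := lk (Ordinal mn); have := kl (Ordinal mn) j jm; lia.
Qed.

(** Builds the shadowing point, with [P j] the coordinates visited during the
    [j]-th segment. The index of the set containing [t] is chosen classically;
    [j0] supplies the values outside all the sets. *)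
Lemma glue_disjoint (G X J : Type) (P : J -> set G) (y : J -> G -> X) (j0 : J) :
    (forall t j j', P j t -> P j' t -> j = j') ->
  exists x : G -> X, forall j t, P j t -> x t = y j t.
Proof.
move=> disj.
have /choice[f fP] : forall t, exists j, forall j', P j' t -> j' = j.
  move=> t; have [[j Pj]|no] := pselect (exists j, P j t).
    by exists j => j' Pj'; exact: disj Pj' Pj.
  by exists j0 => j' Pj'; exfalso; apply: no; exists j'.
by exists (fun t => y (f t) t) => j t Pjt; rewrite -(fP _ _ Pjt).
Qed.

Lemma cvg_cst_div_nat (R : realType) (M : nat) :
  ((fun n : nat => M%:R / n%:R : R) @ \oo --> (0 : R))%R.
Proof.
rewrite -cvg_shiftS; have := @cvg_harmonic R.
by move/(cvgMl_tmp (a := M%:R%R)); rewrite mulr0.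
Qed.

Lemma weak_specification_almost (R : realType) (Y : uniformType) (h : Y -> Y) :
  weak_specification R h -> almost_weak_specification R h.
Proof. by move=> wh a /wh[M MP]; exists (fun=> M). Qed.

Lemma almost_weak_specification_aperiodic (R : realType) (X : finType)
    (G : Type) (phi : G -> G) : (2 <= #|X|)%N ->
  almost_weak_specification R (@generalized_shift X G phi) ->
  ~ exists t : G, periodic_point phi t.
Proof.
move=> /card_gt1P[a [b [_ _ /eqP ab]]] aw [t [p [p1 pt]]].
have ent : entourage (@agree_on X G [set t]).
  by rewrite entourage_full_shiftE; exists [set t] => //; exact: finite_set1.
have [N [_ NP]] := aw _ ent.
(* The two times at which the orbit of [t] is back at [t]; the factor
   [(N 0).+1] makes their distance positive and at least [N 0]. *)
pose l (j : 'I_2) := (j * (p * (N 0%N).+1))%N.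
pose y (j : 'I_2) : full_shift X G := fun=> if j == ord0 then a else b.
have big : (N 0%N < p * (N 0%N).+1)%N by exact: leq_pmull.
have [||||x xP] := NP 2 y l l => //.
- by move=> i j ji; rewrite /l ji; lia.
- by move=> i j ji; rewrite /l ji subnn; lia.
have value (j : 'I_2) : x t = y j t.
  have := xP j (l j); rewrite leqnn => /(_ erefl t erefl) /=.
  rewrite !iter_generalized_shift.
  by rewrite /l mulnCA iter_periodM.
by apply: ab; rewrite -[a]/(y ord0 t) -[b]/(y (lift ord0 ord0) t) -!value.
Qed.

Lemma aperiodic_weak_specification (R : realType) (X : finType) (G : Type)
    (phi : G -> G) :
  ~ (exists t : G, periodic_point phi t) ->
  weak_specification R (@generalized_shift X G phi).
Proof.
move=> aper D; rewrite entourage_full_shiftE => -[H finH HD].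
have [M MP] := orbit_lag_bounded aper finH.
exists M; split; first exact: cvg_cst_div_nat.
move=> n y l k n2 lk kl gap.
have apart := segments_apart lk kl gap.
pose P (j : 'I_n) : set G :=
  [set u | exists t i, [/\ H t, (l j <= i <= k j)%N & u = iter i phi t]].
have noclash (j j' : 'I_n) u : P j u -> P j' u -> ~ (j < j')%N.
  move=> [t [i [Ht ij ->]]] [t' [i' [Ht' ij' e]]] jj'.
  by have := MP _ _ _ _ Ht Ht' e; have := apart _ _ jj'; lia.
have [||x xP] := @glue_disjoint G X 'I_n P y.
- exact: Ordinal (ltnW n2).
- move=> u j j' Pj Pj'; apply: val_inj => /=.
  by have := noclash _ _ _ Pj Pj'; have := noclash _ _ _ Pj' Pj; lia.
exists x => j i ij; apply: HD => t Ht /=.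
by rewrite !iter_generalized_shift; apply: xP; exists t, i.
Qed.

Theorem theorem3p4 (R : realType) (X : finType) (cardX : (2 <= #|X|)%N)
    (G : Type) (G_neq0 : [set: G] !=set0) (phi : G -> G) :
  [<-> weak_specification R (@generalized_shift X G phi);
       almost_weak_specification R (@generalized_shift X G phi);
       ~ exists t : G, periodic_point phi t].
Proof.
tfae.
- exact: weak_specification_almost.
- exact: almost_weak_specification_aperiodic.
- exact: aperiodic_weak_specification.
Qed.
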